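(* Suppose the standing assumption on $C,h,f,\Psi$ (see context) holds, let $F=f+\Psi$, let $f$ be $L$-smooth relative to $h$ on $C$, and let $\gamma$ be a uniform triangle scaling exponent of $D_h$. Let $\{x_k\},\{y_k\},\{z_k\},\{\theta_k\}$ be generated by the ABPG method (described in the context) with this $\gamma$. If $\theta_k\le\frac{\gamma}{k+\gamma}$ for all $k\ge0$, then for any $x\in\operatorname{dom}h$, $$F(x_{k+1})-F(x)\le\left(\frac{\gamma}{k+\gamma}\right)^{\gamma}L\,D_h(x,x_0),\qquad\forall\,k\ge0 .$$
   Context: Problem: minimize $F(x)=f(x)+\Psi(x)$ over $x\in C$, where $f$ is differentiable on an open set containing $\operatorname{rint}C$ ($\operatorname{rint}$ = relative interior). Standing assumption: $C\subset\mathbb{R}^n$ is a closed convex set and $h:\mathbb{R}^n\to(-\infty,+\infty]$ is strictly convex and differentiable on an open set containing $\operatorname{rint}C$. Moreover: (1) $h$ is of Legendre type, i.e. essentially smooth and strictly convex in $\operatorname{rint}\operatorname{dom}h$, where essentially smooth means that it is differentiable and $\|\nabla h(x_k)\|\to\infty$ for every sequence $\{x_k\}$ converging to a boundary point of $\operatorname{dom}h$; (2) $f:\mathbb{R}^n\to(-\infty,\infty]$ is proper, closed and convex, and differentiable on $\operatorname{rint}C$; (3) $\Psi:\mathbb{R}^n\to(-\infty,\infty]$ is proper, closed and convex, with $\operatorname{dom}\Psi\cap\operatorname{rint}\operatorname{dom}h\ne\emptyset$; (4) $\inf_{x\in C}\{f(x)+\Psi(x)\}>-\infty$; (5) the Bregman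 proximal gradient (BPG) step $x_{k+1}=\operatorname{arg\,min}_{x\in C}\{f(x_k)+\langle\nabla f(x_k),x-x_k\rangle+L_kD_h(x,x_k)+\Psi(x)\}$ (with $L_k>0$) is well posed, meaning that $x_{k+1}$ is unique and belongs to $\operatorname{rint}\operatorname{dom}h$. (Under this assumption the ABPG method below is also regarded as well posed: $z_{k+1}$ is unique and always in $\operatorname{rint}C$.) Bregman distance: $D_h(x,y)=h(x)-h(y)-\langle\nabla h(y),x-y\rangle$ for $x\in\operatorname{dom}h$, $y\in\operatorname{rint}\operatorname{dom}h$. Relative smoothness: $f$ is $L$-smooth relative to $h$ on $C$ if $L>0$ and $f(x)\le f(y)+\langle\nabla f(y),x-y\rangle+L\,D_h(x,y)$ for all $x\in C$, $y\in\operatorname{rint}C$. Uniform triangle scaling exponent (TSE): $\gamma>0$ is a uniform TSE of $D_h$ if for all $x,z,\tilde z\in\operatorname{rint}\operatorname{dom}h$ and all $\theta\in[0,1]$, $D_h((1-\theta)x+\theta z,(1-\theta)x+\theta\tilde z)\le\theta^\gamma D_h(z,\tilde z)$. Linearization: $\ell(x|y)=f(y)+\langle\nabla f(y),x-y\rangle+\Psi(x)$. ABPG method (accelerated Bregman proximal gradient): input $x_0\in\operatorname{rint}C$ and $\gamma\ge1$; set $z_0=x_0$, $\theta_0=1$. For $k=0,1,2,\dots$: $y_k=(1-\theta_k)x_k+\theta_kz_k$; $z_{k+1}=\operatorname{arg\,min}_{z\in C}\{\ell(z|y_k)+\theta_k^{\gamma-1}L\,D_h(z,z_k)\}$; $x_{k+1}=(1-\theta_k)x_k+\theta_kz_{k+1}$;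 choose $\theta_{k+1}\in(0,1]$ such that $\frac{1-\theta_{k+1}}{\theta_{k+1}^\gamma}\le\frac1{\theta_k^\gamma}$.
   Formalization: The comparison point x is required to lie in dom h and in the affine hull of C; for arbitrary x in dom h the claim fails, e.g. C={1}, h=f=x²/2, Ψ=0, L=1, γ=2, θ_k=2/(k+2), x=0, k≥1. *)

(* Defs.v *)
(* MathComp / MathComp-Analysis. *)
From HB Require Import structures.
From mathcomp Require Import all_boot all_order all_algebra.
From mathcomp Require Import all_classical all_reals all_analysis.

Set Implicit Arguments.
Unset Strict Implicit.
Unset Printing Implicit Defensive.

Import Order.TTheory GRing.Theory Num.Theory.
Import numFieldNormedType.Exports.

Local Open Scope classical_set_scope.
Local Open Scope ring_scope.
Local Open Scope ereal_scope.

(* A function R^n -> (-oo, +oo] is encoded as g : 'rV[R]_n -> \bar R together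
   with the condition that it never takes the value -oo.  The topology of
   'rV[R]_n comes from the sup norm; every norm used below is Euclidean. *)

Section ConvexAnalysis.
Context {R : realType} {n : nat}.
Implicit Types (A : set 'rV[R]_n) (g h : 'rV[R]_n -> \bar R).
Implicit Types (x y u v : 'rV[R]_n).

Definition dot u v : R := (\sum_i u 0 i * v 0 i)%R.

Definition enorm u : R := Num.sqrt (dot u u).

Definition affine_hull A : set 'rV[R]_n :=
  [set x | exists (m : nat) (a : 'I_m -> R) (p : 'I_m -> 'rV[R]_n),
    [/\ forall i, A (p i), (\sum_i a i = 1)%R & x = (\sum_i a i *: p i)%R]].

(* Interior of A relative to its affine hull. *)
Definition rint A : set 'rV[R]_n :=
  [set x | A x /\ \forall y \near x, affine_hull A y -> A y].

Definition edom g : set 'rV[R]_n := [set x | g x < +oo].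

Definition never_ninfty g := forall x, -oo < g x.

Definition proper_fun g := never_ninfty g /\ edom g !=set0.

Definition epigraph g : set ('rV[R]_n * R) := [set p | g p.1 <= p.2%:E].

Definition closed_fun g := closed (epigraph g).

(* For functions avoiding -oo; the conventions 0 * +oo = 0 and x + +oo = +oo
   make the inequality the usual one. *)
Definition convex_fun g := forall x y (t : R), (0 <= t <= 1)%R ->
  g (t *: x + (1 - t) *: y)%R <= t%:E * g x + (1 - t)%:E * g y.

Definition strictly_convex_on A g := forall x y (t : R),
  A x -> A y -> x <> y -> (0 < t < 1)%R ->
  g (t *: x + (1 - t) *: y)%R < t%:E * g x + (1 - t)%:E * g y.

(* Differentiability of an extended-valued function at x requires finiteness
   around x; in particular x is interior to the domain. *)
Definition ediff g x :=
  (\forall y \near x, g y \is a fin_num) /\ differentiable (fine \o g) x.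

Definition grad g x : 'rV[R]_n := (\row_i 'D_(delta_mx 0 i) (fine \o g) x)%R.

Definition boundary_set A : set 'rV[R]_n := closure A `\` interior A.

Definition essentially_smooth h :=
  (forall x, interior (edom h) x -> ediff h x) /\
  (forall (u : nat -> 'rV[R]_n) (b : 'rV[R]_n),
     (forall k, interior (edom h) (u k)) -> boundary_set (edom h) b ->
     u k @[k --> \oo] --> b ->
     (enorm (grad h (u k)))%:E @[k --> \oo] --> +oo).

Definition legendre h :=
  essentially_smooth h /\ strictly_convex_on (rint (edom h)) h.

(* Equal to +oo when x is outside the domain of h. *)
Definition bregman h x y : \bar R :=
  h x - h y - (dot (grad h y) (x - y))%:E.

Definition argmin A g : set 'rV[R]_n :=
  [set z | A z /\ forall w, A w -> g z <= g w].

End ConvexAnalysis.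

Section Problem.
Context {R : realType} {n : nat}.
Implicit Types (C : set 'rV[R]_n) (h f Psi : 'rV[R]_n -> \bar R).
Implicit Types (x y z : 'rV[R]_n).

(* The linearization l(x | y). *)
Definition linearization f Psi x y : \bar R :=
  f y + (dot (grad f y) (x - y))%:E + Psi x.

Definition relatively_smooth C h f (L : R) :=
  (0 < L)%R /\
  forall x y, C x -> rint C y ->
    f x <= f y + (dot (grad f y) (x - y))%:E + L%:E * bregman h x y.

Definition uniform_TSE h (gamma : R) :=
  (0 < gamma)%R /\
  forall x z z' (theta : R),
    rint (edom h) x -> rint (edom h) z -> rint (edom h) z' ->
    (0 <= theta <= 1)%R ->
    bregman h ((1 - theta) *: x + theta *: z)%R
              ((1 - theta) *: x + theta *: z')%R
    <= (theta `^ gamma)%:E * bregman h z z'.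

(* In [sa_bpg], xk ranges over the relative interior of C, where the gradients
   of f and h at xk are meaningful. *)
Record standing_assumption C h f Psi : Prop := StandingAssumption {
  sa_C_closed : closed C ;
  sa_C_convex : convex_set C ;
  sa_h_ninfty : never_ninfty h ;
  sa_h_convex : convex_fun h ;
  sa_h_smooth : exists U : set 'rV[R]_n,
    [/\ open U, rint C `<=` U, strictly_convex_on U h &
        forall x, U x -> ediff h x] ;
  sa_h_legendre : legendre h ;
  sa_f_proper : proper_fun f ;
  sa_f_closed : closed_fun f ;
  sa_f_convex : convex_fun f ;
  sa_f_smooth : exists U : set 'rV[R]_n,
    [/\ open U, rint C `<=` U & forall x, U x -> ediff f x] ;
  sa_Psi_proper : proper_fun Psi ;
  sa_Psi_closed : closed_fun Psi ;
  sa_Psi_convex : convex_fun Psi ;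
  sa_Psi_dom : edom Psi `&` rint (edom h) !=set0 ;
  sa_bounded_below : -oo < ereal_inf [set f x + Psi x | x in C] ;
  sa_bpg : forall xk (Lk : R), rint C xk -> (0 < Lk)%R ->
    exists2 xk1, rint (edom h) xk1 &
      argmin C (fun x => f xk + (dot (grad f xk) (x - xk))%:E
                         + Lk%:E * bregman h x xk + Psi x) = [set xk1]
}.

(* Well-posedness of the method is part of the record: z_{k+1} is the only
   minimizer ([abpg_z]) and lies in the relative interior of C
   ([abpg_z_rint]). *)
Record ABPG C h f Psi (L gamma : R)
    (x y z : nat -> 'rV[R]_n) (theta : nat -> R) : Prop := ABPGSequence {
  abpg_gamma : (1 <= gamma)%R ;
  abpg_x0 : rint C (x 0%N) ;
  abpg_z0 : z 0%N = x 0%N ;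
  abpg_theta0 : theta 0%N = 1%R ;
  abpg_y : forall k, y k = ((1 - theta k) *: x k + theta k *: z k)%R ;
  abpg_z : forall k,
    argmin C (fun w => linearization f Psi w (y k)
       + (theta k `^ (gamma - 1))%:E * L%:E * bregman h w (z k))
    = [set z k.+1] ;
  abpg_z_rint : forall k, rint C (z k.+1) ;
  abpg_x : forall k, x k.+1 = ((1 - theta k) *: x k + theta k *: z k.+1)%R ;
  abpg_theta_itv : forall k, (0 < theta k.+1 <= 1)%R ;
  abpg_theta : forall k,
    ((1 - theta k.+1) / theta k.+1 `^ gamma <= 1 / theta k `^ gamma)%R
}.

End Problem.

(* Main.v *)
Require Import Defs.
From HB Require Import structures.
From mathcomp Require Import all_boot all_order all_algebra.
From mathcomp Require Import all_classical all_reals all_analysis.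
From mathcomp Require Import ring lra.

Set Implicit Arguments.
Unset Strict Implicit.
Unset Printing Implicit Defensive.

Import Order.TTheory GRing.Theory Num.Theory.
Import numFieldNormedType.Exports.

Local Open Scope classical_set_scope.
Local Open Scope ring_scope.

(** Put [c_k = 1 / theta_k ^ gamma] and
    [tau_k = ((k + gamma) / gamma) ^ gamma], so that [tau_k <= c_k]. Combining
    relative smoothness at [y_k], triangle scaling, convexity of [f] and [Psi]
    and the three-point inequality for the subproblem defining [z_(k+1)], one
    gets ([abpg_step]), for every [v] in the affine hull of [C] at which [h],
    [f] and [Psi] are finite,

      [c_k (F x_(k+1) - F v) + L D(v, z_(k+1))
         <= (1 - theta_k) c_k (F x_k - F v) + L D(v, z_k)].

    The point [v] may lie outside [C], because [z_(k+1)] is in the relative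
    interior of [C] and so is stationary along the whole affine hull.

    Since [(1 - theta_(k+1)) c_(k+1) <= c_k], this telescopes to the rate as
    long as [F x_k >= F u]. The difficulty is that an iterate may fall below
    [F u] and a later one may rise again; then the inequality between the
    coefficients acts in the wrong direction. Two cases are distinguished.

    If [gamma = 1], the conditions on [theta] force [theta_k = 1 / (k + 1)];
    then [(1 - theta_(k+1)) c_(k+1) = c_k], and the sum telescopes whatever the
    signs of the differences ([descent_exact]).

    If [gamma > 1], then [h] is a quadratic function. Triangle scaling makes
    the increments of the gradient on approach to a boundary point of [dom h]
    geometrically small, so that the gradient stays bounded there, against
    essential smoothness; hence [h] is finite and differentiable everywhere
    ([edom_everywhere]). On the whole space, triangle scaling in the limit
    [theta -> 1] makes [D] invariant under translations, which forces the
    gradient of [h] to be affine ([grad_affine]) and [gamma <= 2] ([tse_le2]).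
    The iterate [x_k] is a weighted average of [z_1, ..., z_k]; as the
    gradient is affine, the average of [D(v, z_j) - D(x_k, z_j)] with the same
    weights is [D(v, x_k) >= 0].

    This allows a change of comparator ([descent_record]): as soon as
    [x_(k+1)] is better than the current comparator [v] (initially [u]), it
    replaces [v], so that the relevant differences are never negative. The
    change costs the decrease [F v - F x_(k+1)] times the average of the
    weights [c_(j-1)], which is at most [tau_(k+1)] ([wavg_weight_le]); this
    much is gained back in the final estimate because the objective is then
    compared with a smaller value than [F u]. *)

(** * Real powers *)

Section RealPowers.
Context {R : realType}.
Implicit Types (r a g x y : R).

Lemma ler_powR_base r x y : 0 <= r -> 0 <= x -> x <= y -> x `^ r <= y `^ r.
Proof.
by move=> r0 x0 xy; apply: ge0_ler_powR; rewrite ?nnegrE // (le_trans x0).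
Qed.

(** Concavity of [r ^ a] in [r], in the form of the weighted inequality between
    arithmetic and geometric means for [r] and [1]. *)
Lemma powR_le_tangent r a : 0 < r -> 0 <= a <= 1 -> r `^ a <= 1 + a * (r - 1).
Proof.
move=> r0 /andP[a0 a1]; set w := 1 + a * (r - 1).
have w0 : 0 < w.
  rewrite /w; move: a0; rewrite le_eqVlt => /predU1P[<-|a0]; first by lra.
  by have := mulr_gt0 a0 r0; lra.
have lnb y : 0 < y -> ln y <= y - 1.
  move=> y0; have -> : y = 1 + (y - 1) by lra.
  by apply: (le_trans (le_ln1Dx _)); lra.
have h1 : ln r - ln w <= r / w - 1.
  by rewrite -ln_div ?posrE //; apply: lnb; exact: divr_gt0.
have h2 : - ln w <= w^-1 - 1.
  by rewrite -lnV ?posrE //; apply: lnb; rewrite invr_gt0.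
rewrite -ler_ln ?posrE ?powR_gt0 // ln_powR -subr_ge0.
have e : a * (r / w - 1) + (1 - a) * (w^-1 - 1) = 0.
  have -> : a * (r / w - 1) + (1 - a) * (w^-1 - 1) = w / w - 1.
    by rewrite {3}/w; ring.
  by rewrite divff ?subrr ?gt_eqF.
have k1 : a * (ln r - ln w) <= a * (r / w - 1) by exact: ler_wpM2l.
have k2 : (1 - a) * (- ln w) <= (1 - a) * (w^-1 - 1).
  by apply: ler_wpM2l => //; lra.
rewrite -/w in e *; lra.
Qed.

Lemma bernoulli_powR x g : 0 <= x -> 1 <= g -> 1 + g * x <= (1 + x) `^ g.
Proof.
move=> x0 g1; have g0 : 0 < g by lra.
have y0 : 0 < 1 + g * x by have := mulr_ge0 (ltW g0) x0; lra.
have h : (1 + g * x) `^ g^-1 <= 1 + x.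
  have /(powR_le_tangent y0) : 0 <= g^-1 <= 1.
    by rewrite invr_ge0 (ltW g0) invf_le1.
  rewrite addrAC subrr add0r mulrA mulVf ?mul1r //; lra.
have -> : 1 + g * x = ((1 + g * x) `^ g^-1) `^ g.
  by rewrite -powRrM mulVf ?gt_eqF // powRr1 // ltW.
by apply: ler_powR_base => //; [exact: ltW | exact: powR_ge0].
Qed.

End RealPowers.

(** * Step sizes and weighted averages *)

Section StepSizes.
Context {R : realType}.
Variables (theta : nat -> R) (g : R).
Hypothesis theta0 : theta 0%N = 1.
Hypothesis theta_itv : forall k, 0 < theta k <= 1.
Hypothesis theta_rec : forall k,
  (1 - theta k.+1) / theta k.+1 `^ g <= 1 / theta k `^ g.

(** The average of [q 1, ..., q k] with the weights for which [x k] is the average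
    of [z 1, ..., z k]; they sum to [1] because [theta 0 = 1]. *)
Fixpoint wavg (q : nat -> R) k : R :=
  if k is j.+1 then (1 - theta j) * wavg q j + theta j * q j.+1 else 0.

Lemma theta_gt0 k : 0 < theta k. Proof. by have /andP[] := theta_itv k. Qed.

Lemma theta_le1 k : theta k <= 1. Proof. by have /andP[] := theta_itv k. Qed.

Lemma wavg_cst a k : wavg (fun=> a) k.+1 = a.
Proof.
elim: k => [|k IH]; first by rewrite /= theta0; ring.
by rewrite [LHS]/= -/(wavg _ k.+1) IH; ring.
Qed.

Lemma wavgD p q k : wavg (fun j => p j + q j) k = wavg p k + wavg q k.
Proof. by elim: k => [|k /= ->]; [rewrite addr0 | ring]. Qed.

Lemma wavgZ a q k : wavg (fun j => a * q j) k = a * wavg q k.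
Proof. by elim: k => [|k /= ->]; [rewrite mulr0 | ring]. Qed.

Lemma wavg_le p q k : (forall j, (0 < j <= k)%N -> p j <= q j) ->
  wavg p k <= wavg q k.
Proof.
elim: k => [//|k IH] pq /=; apply: lerD; apply: ler_wpM2l.
- by rewrite subr_ge0 theta_le1.
- by apply: IH => j /andP[j0 jk]; apply: pq; rewrite j0 leqW.
- exact/ltW/theta_gt0.
- by apply: pq; rewrite ltnS leqnn.
Qed.

Definition weight k := (theta k `^ g)^-1.

Definition target k := ((k%:R + g) / g) `^ g.

Lemma weight_gt0 k : 0 < weight k.
Proof. by rewrite invr_gt0 powR_gt0 // theta_gt0. Qed.

Lemma weight_rec k : (1 - theta k.+1) * weight k.+1 <= weight k.
Proof. by have := theta_rec k; rewrite div1r. Qed.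

(** The recursion bounds [1 / theta (k + 1)] in terms of [1 / theta k]; the sharp
    increment tends to [1 / g], and the increment [8 / (5 g)] is already enough for
    all [k]. The constant [8 / 5] is a rational just below the golden ratio, which
    is the limit of what [wavg_weight_le] can use. *)
Lemma theta_inv_le k : 1 <= g <= 2 ->
  (theta k)^-1 <= 8%:R / 5%:R * (1 + k%:R / g).
Proof.
move=> /andP[g1 g2]; have g0 : 0 < g by lra.
elim: k => [|k IH]; first by rewrite theta0 invr1 mul0r; lra.
set B := _ * (1 + k%:R / g) in IH.
set d := 8%:R / 5%:R / g : R.
have -> : 8%:R / 5%:R * (1 + k.+1%:R / g) = B + d.
  by rewrite /B /d -natr1; field; rewrite gt_eqF.
have B1 : 8%:R / 5%:R <= B.
  have : 0 <= k%:R / g by rewrite divr_ge0 ?ler0n ?ltW.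
  rewrite /B; lra.
have gd : g * d = 8%:R / 5%:R by rewrite /d; field; rewrite gt_eqF.
rewrite leNgt; apply/negP => lt_t.
set t := (theta k.+1)^-1 in lt_t.
have d0 : 0 < d by rewrite /d divr_gt0 //; lra.
have t0 : 0 < t by rewrite invr_gt0 theta_gt0.
have thE : theta k.+1 = t^-1 by rewrite invrK.
set r := B / t.
have r0 : 0 < r by rewrite divr_gt0 //; lra.
have rt : r * t = B by rewrite /r divfK // gt_eqF.
have r1 : r <= 1 by rewrite /r ler_pdivrMr // mul1r; lra.
have h1 : 1 - t^-1 <= r `^ g.
  have -> : t^-1 = theta k.+1 by rewrite invrK.
  have pos : 0 < theta k `^ g by rewrite powR_gt0 // theta_gt0.
  have : 1 - theta k.+1 <= (theta k.+1 / theta k) `^ g.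
    have := weight_rec k; rewrite /weight ler_pdivrMr ?powR_gt0 ?theta_gt0 //.
    move=> /le_trans; apply.
    have -> : theta k.+1 `^ g = (theta k.+1 / theta k) `^ g * theta k `^ g.
      rewrite -powRM ?divfK ?gt_eqF ?theta_gt0 // ?divr_ge0 //;
        exact/ltW/theta_gt0.
    by rewrite mulrCA mulVf ?mulr1 // gt_eqF.
  move=> /le_trans; apply; apply: ler_powR_base; first exact: ltW.
    by rewrite divr_ge0 ?ltW ?theta_gt0.
  by rewrite /r /t invrK mulrC ler_pM2r ?theta_gt0.
have h2 : r `^ g <= r * (1 + (g - 1) * (r - 1)).
  rewrite -mulr_powRB1 ?ler_pM2l ?(ltW r0) //.
  by apply: powR_le_tangent => //; lra.
have tt : t^-1 * t = 1 by rewrite mulVf // gt_eqF.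
have h3 : t - 1 <= B * (1 + (g - 1) * (r - 1)).
  have := ler_wpM2r (ltW t0) (le_trans h1 h2).
  by rewrite mulrBl mul1r tt mulrAC rt.
have h4 : t ^+ 2 - t <= B * (t + (g - 1) * (B - t)).
  have := ler_wpM2r (ltW t0) h3.
  have -> : (t - 1) * t = t ^+ 2 - t by ring.
  have -> : B * (1 + (g - 1) * (r - 1)) * t = B * (t + (g - 1) * (r * t - t)) by ring.
  by rewrite rt.
set e := t - B - d.
have e0 : 0 < e by rewrite /e; lra.
have tE : t = B + d + e by rewrite /e; lra.
clearbody e.
(* With [u = t - B > d], the bound [h4] reads [g B u + u^2 <= B + u]; but
   [g d = 8/5], so that [g B u - B > 3 B / 5 > 1/4 >= u - u^2]. *)
have gBe : 0 <= g * B * e by apply: mulr_ge0; [apply: mulr_ge0; lra | exact: ltW].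
have gBd : g * B * d = B * (8%:R / 5%:R) by rewrite -gd; ring.
have sq := sqr_ge0 (d + e - 1 / 2%:R).
move: h4; rewrite tE => h4.
have : g * B * d + g * B * e + (d + e) ^+ 2 <= B + d + e.
  have -> : g * B * d + g * B * e + (d + e) ^+ 2 =
    ((B + d + e) ^+ 2 - (B + d + e)) -
    B * (B + d + e + (g - 1) * (B - (B + d + e))) + (B + d + e) by ring.
  lra.
rewrite gBd; nra.
Qed.

(** With [q = 1 + k / g], one step adds at least [q ^ (g - 1)] to the target by
    Bernoulli's inequality, and [r ^ (g - 1) - 1 / r] times this number to the
    bound on the average, where [r = 1 / (q theta_k)]. This factor is at most
    [1], since [r <= 8 / 5] and [r ^ (g - 1)] is at most [r] if [1 <= r], and at
    most [1] otherwise. *)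
Lemma wavg_weight_le k : 1 <= g <= 2 -> wavg (weight \o predn) k <= target k.
Proof.
move=> g12; have /andP[g1 g2] := g12; have g0 : 0 < g by lra.
elim: k => [|k IH]; first exact: powR_ge0.
rewrite /= -/(wavg _ _) /target in IH *; set q := (k%:R + g) / g in IH.
have q1 : 1 <= q by rewrite /q ler_pdivlMr // mul1r lerDr.
have q0 : 0 < q by lra.
have th0 := theta_gt0 k.
have qE : q = 1 + k%:R / g by rewrite /q; field; rewrite gt_eqF.
set r := (theta k * q)^-1.
have r0 : 0 < r by rewrite invr_gt0 mulr_gt0.
have thE : (theta k)^-1 = r * q by rewrite /r; field; rewrite !gt_eqF.
have r85 : r <= 8%:R / 5%:R.
  by have := theta_inv_le k g12; rewrite thE -qE ler_pM2r.
have rr : r `^ (g - 1) <= 1 + r^-1.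
  have [r1|r1] := leP 1 r.
    have /le_trans : r `^ (g - 1) <= r by apply: ler1_powR => //; lra.
    apply; have : r * r^-1 = 1 by rewrite divff // gt_eqF.
    have : 0 < r^-1 by rewrite invr_gt0.
    nra.
  have : r `^ (g - 1) <= 1.
    rewrite -[leRHS](powRr0 r).
    by apply: ger_powR; [rewrite r0 ltW | lra].
  have : 0 < r^-1 by rewrite invr_gt0.
  lra.
set Y := q `^ g / q.
have Y0 : 0 < Y by rewrite divr_gt0 ?powR_gt0.
have qY : q `^ g = q * Y by rewrite /Y mulrC divfK ?gt_eqF.
have thqY : theta k * q `^ g = r^-1 * Y.
  by rewrite qY mulrA /r invrK.
have thw : theta k * weight k = r `^ (g - 1) * Y.
  have e : weight k = r * r `^ (g - 1) * (q * Y).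
    rewrite mulr_powRB1 ?ltW // -qY -powRM ?ltW // -thE /weight.
    by rewrite -(powR_inv1 (ltW th0)) -powRrM mulN1r powRN.
  by rewrite e /r; field; rewrite !gt_eqF.
have le_target : (q + 1) * Y <= ((k.+1%:R + g) / g) `^ g.
  have -> : (k.+1%:R + g) / g = q * (1 + (g * q)^-1).
    by rewrite /q -natr1; field; rewrite !gt_eqF // ltr_wpDl.
  rewrite powRM ?(ltW q0) //; last by rewrite addr_ge0 // invr_ge0 ltW // mulr_gt0.
  have -> : (q + 1) * Y = q `^ g * (1 + g * (g * q)^-1).
    by rewrite qY; field; rewrite !gt_eqF.
  rewrite ler_pM2l ?powR_gt0 //; apply: bernoulli_powR => //.
  by rewrite invr_ge0 ltW // mulr_gt0.
apply: le_trans le_target.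
have h : (1 - theta k) * wavg (weight \o predn) k <= (1 - theta k) * q `^ g.
  by apply: ler_wpM2l => //; rewrite subr_ge0 theta_le1.
have := ler_wpM2r (ltW Y0) rr.
rewrite thw; move: h; rewrite [in X in _ <= X -> _]mulrBl mul1r thqY qY; lra.
Qed.

Lemma target_gt0 k : 0 < g -> 0 < target k.
Proof. by move=> g0; rewrite powR_gt0 // divr_gt0 // ltr_wpDl. Qed.

Lemma target_le k : 0 < g -> target k <= target k.+1.
Proof.
move=> g0; apply: ler_powR_base; first exact: ltW.
  by rewrite divr_ge0 ?addr_ge0 ?(ltW g0).
by rewrite ler_pM2r ?invr_gt0 // lerD2r ler_nat.
Qed.

Lemma target_le_weight k : 0 < g -> theta k <= g / (k%:R + g) ->
  target k <= weight k.
Proof.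
move=> g0 thk; have kg0 : 0 < k%:R + g by rewrite ltr_wpDl.
have th0 := theta_gt0 k.
rewrite /weight -powRN -mulN1r powRrM powR_inv1 ?(ltW th0) //.
apply: ler_powR_base; first exact: ltW.
  by rewrite divr_ge0 ?(ltW g0) ?(ltW kg0).
by rewrite -[leLHS]invrK lef_pV2 ?posrE ?invr_gt0 ?divr_gt0 // invf_div.
Qed.

(** * The descent recursion *)

(** An abstract version of the method: [S] is the set of admissible comparators and
    [d v k] stands for [L D(v, z_k)]. *)
Section Descent.
Variables (T : Type) (S : T -> Prop) (F : T -> R) (d : T -> nat -> R).
Variables (x : nat -> T) (u : T).
Hypothesis d_ge0 : forall v k, S v -> 0 <= d v k.
Hypothesis x_S : forall k, S (x k.+1).
Hypothesis u_S : S u.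
Hypothesis step : forall v k, S v ->
  weight k * (F (x k.+1) - F v) + d v k.+1
  <= (1 - theta k) * weight k * (F (x k) - F v) + d v k.

Lemma target_mul_le e k : 0 < g -> theta k <= g / (k%:R + g) -> 0 <= d u 0%N ->
  weight k * e <= d u 0%N -> target k * e <= d u 0%N.
Proof.
move=> g0 thk d0; have [e0|/ltW e0] := leP 0 e.
  by apply: le_trans; apply: ler_wpM2r => //; exact: target_le_weight.
by move=> _; apply: le_trans d0; apply: mulr_ge0_le0 => //; exact/ltW/target_gt0.
Qed.

(** When [g = 1], the recursion gives [1 / theta_k <= k + 1] and the upper bound on
    [theta_k] gives the converse. The two coefficients of the recursion are then
    equal, and it telescopes for differences of any sign. *)
Lemma descent_exact k : g = 1 ->
  (forall k, theta k <= g / (k%:R + g)) ->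
  target k * (F (x k.+1) - F u) <= d u 0%N.
Proof.
move=> g1 thle; apply: target_mul_le => //; [by rewrite g1 | exact: d_ge0 |].
have wE j : weight j = (j.+1)%:R.
  have wth i : weight i = (theta i)^-1.
    by rewrite /weight g1 powRr1 // ltW // theta_gt0.
  apply/eqP; rewrite eq_le; apply/andP; split.
    elim: j => [|j IH]; first by rewrite wth theta0 invr1.
    have := weight_rec j; rewrite mulrBl mul1r {2}wth divff ?gt_eqF ?theta_gt0 //.
    by rewrite -(natr1 j.+1); lra.
  rewrite wth -[leLHS]invrK lef_pV2 ?posrE ?invr_gt0 ?ltr0n ?theta_gt0 //.
  by have := thle j; rewrite g1 natr1 div1r.
have h j : weight j * (F (x j.+1) - F u) + d u j.+1 <= d u 0%N.
  elim: j => [|j IH]; apply: le_trans (step _ u_S) _.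
    by rewrite theta0 subrr !mul0r add0r.
  suff -> : (1 - theta j.+1) * weight j.+1 = weight j by [].
  have th : theta j.+1 * weight j.+1 = 1.
    rewrite /weight g1 powRr1 ?divff ?gt_eqF ?theta_gt0 //.
    exact/ltW/theta_gt0.
  by rewrite mulrBl mul1r th !wE -natr1; ring.
by have := h k; have := d_ge0 k.+1 u_S; lra.
Qed.

(** For a comparator below the objective along the iterates from [j] to [k], the
    quantity [weight (i - 1) (F x_i - F v) + d v i] does not increase with [i]. *)
Lemma descent_from v k j : S v -> (0 < j <= k)%N ->
  (forall i, (j <= i <= k)%N -> F v <= F (x i)) ->
  d v k <= weight j.-1 * (F (x j) - F v) + d v j.
Proof.
move=> vS /andP[j0 jk] Fv; have h : forall i, (j <= i <= k)%N ->
    weight i.-1 * (F (x i) - F v) + d v i <=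
    weight j.-1 * (F (x j) - F v) + d v j.
  elim=> [|i IH]; first by rewrite leqn0 (gtn_eqF j0).
  rewrite leq_eqVlt ltnS => /andP[/predU1P[<- //|ji] ik].
  have jik : (j <= i <= k)%N by rewrite ji ltnW.
  have i0 : (0 < i)%N by exact: leq_trans ji.
  apply: le_trans (IH jik); apply: le_trans (step _ vS) _; rewrite lerD2r.
  apply: ler_wpM2r; first by rewrite subr_ge0 Fv.
  by have := weight_rec i.-1; rewrite prednK.
have := h k; rewrite jk leqnn => /(_ isT).
have : 0 <= weight k.-1 * (F (x k) - F v).
  by rewrite mulr_ge0 ?(ltW (weight_gt0 _)) // subr_ge0 Fv // jk leqnn.
lra.
Qed.

Hypothesis g12 : 1 <= g <= 2.
Hypothesis theta_le : forall k, theta k <= g / (k%:R + g).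
Hypothesis wavg_d : forall v k, S v ->
  wavg (d (x k.+1)) k.+1 <= wavg (d v) k.+1.

(** The comparator [v] is [u] or the best iterate so far. The last two estimates
    control the energy relative to [v] at step [k], and its average over the past
    steps. The average is what survives a change of comparator, by [wavg_d]; it then
    yields the estimate at step [k] for the new comparator, whose energy has been
    nonincreasing in the past ([descent_from]). *)
Lemma descent_record k : exists v, [/\ S v, F v <= F u,
  forall j, (0 < j <= k)%N -> F v <= F (x j),
  (1 - theta k) * weight k * (F (x k) - F v) + d v k
    <= d u 0%N + target k * (F u - F v) &
  wavg (fun j => weight j.-1 * (F (x j) - F v) + d v j) k
    <= d u 0%N + target k * (F u - F v)].
Proof.
have /andP[g1 g2] := g12; have g0 : 0 < g by lra.
have d0 := d_ge0 0 u_S.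
elim: k => [|k [v [vS vu vx I1 I2]]].
  (* [theta 0 = 1] removes [F (x 0)] from the estimates. *)
  exists u; split=> //; first by case.
    by rewrite theta0 !subrr !mul0r add0r mulr0 addr0.
  by rewrite subrr mulr0 addr0.
have tk := target_le k g0.
have m0 : 0 <= F u - F v by rewrite subr_ge0.
have tm : target k * (F u - F v) <= target k.+1 * (F u - F v) by exact: ler_wpM2r.
have J1 := le_trans (step k vS) I1.
have J2 : wavg (fun j => weight j.-1 * (F (x j) - F v) + d v j) k.+1
    <= d u 0%N + target k.+1 * (F u - F v).
  rewrite [leLHS]/=.
  have th1 : 0 <= 1 - theta k by rewrite subr_ge0 theta_le1.
  have := ler_wpM2l (ltW (theta_gt0 k)) J1.
  have := ler_wpM2l th1 I2; lra.
have [vx1|x1v] := leP (F v) (F (x k.+1)).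
  exists v; split=> //.
    move=> j /andP[j0]; rewrite leq_eqVlt => /predU1P[->//|jk].
    by apply: vx; rewrite j0.
  apply: le_trans (_ : weight k * (F (x k.+1) - F v) + d v k.+1 <= _).
    rewrite lerD2r; apply: ler_wpM2r; first by rewrite subr_ge0.
    exact: weight_rec.
  lra.
have v'S := x_S k.
have v'x j : (0 < j <= k.+1)%N -> F (x k.+1) <= F (x j).
  move=> /andP[j0]; rewrite leq_eqVlt => /predU1P[->//|jk].
  by apply: le_trans (ltW x1v) _; apply: vx; rewrite j0.
have J3 : wavg (fun j => weight j.-1 * (F (x j) - F (x k.+1)) + d (x k.+1) j) k.+1
    <= d u 0%N + target k.+1 * (F u - F (x k.+1)).
  have A_le := wavg_weight_le k.+1 g12.
  have dd := wavg_d k vS.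
  have : wavg (fun j => weight j.-1 * (F (x j) - F (x k.+1)) + d (x k.+1) j) k.+1
      + wavg (d v) k.+1
    = wavg (fun j => weight j.-1 * (F (x j) - F v) + d v j) k.+1
      + (F v - F (x k.+1)) * wavg (weight \o predn) k.+1 + wavg (d (x k.+1)) k.+1.
    rewrite -wavgZ -!wavgD; congr (wavg _ _); apply: boolp.funext => j /=; ring.
  have := ler_wpM2l (_ : 0 <= F v - F (x k.+1)) A_le.
  rewrite subr_ge0 => /(_ (ltW x1v)); lra.
exists (x k.+1); split=> //; first by apply: le_trans vu; exact: ltW.
(* The energy of the new comparator at step [k + 1] is [d (x k.+1) k.+1], and it is
   at most each of the energies averaged in [J3]. *)
rewrite subrr mulr0 add0r -(wavg_cst (d (x k.+1) k.+1) k).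
apply: le_trans J3; apply: wavg_le => j jk.
apply: descent_from => // i /andP[ji ik]; apply: v'x.
by rewrite ik andbT; apply: leq_trans ji; case/andP: jk.
Qed.

Lemma descent_bound k : target k * (F (x k.+1) - F u) <= d u 0%N.
Proof.
have /andP[g1 g2] := g12; have g0 : 0 < g by lra.
have [v [vS vu vx I1 _]] := descent_record k.
have J1 := le_trans (step k vS) I1.
have d1 := d_ge0 k.+1 vS; have d0 := d_ge0 0 u_S.
have t0 := target_gt0 k g0.
have [vx1|/ltW x1v] := leP (F v) (F (x k.+1)).
  have := ler_wpM2r (_ : 0 <= F (x k.+1) - F v) (target_le_weight g0 (theta_le k)).
  rewrite subr_ge0 => /(_ vx1); lra.
apply: le_trans d0; apply: mulr_ge0_le0; first exact: ltW.
by rewrite subr_le0 (le_trans x1v).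
Qed.

End Descent.
End StepSizes.

(** * Inner product and gradient *)

Section Dot.
Context {R : realType} {n : nat}.
Implicit Types (u v w : 'rV[R]_n) (a : R).

Lemma dotDl u v w : dot (u + v) w = dot u w + dot v w.
Proof. by rewrite -big_split; apply: eq_bigr => i _; rewrite mxE mulrDl. Qed.

Lemma dotZl a u v : dot (a *: u) v = a * dot u v.
Proof. by rewrite mulr_sumr; apply: eq_bigr => i _; rewrite mxE mulrA. Qed.

Lemma dotC u v : dot u v = dot v u.
Proof. by apply: eq_bigr => i _; rewrite mulrC. Qed.

Lemma dotDr u v w : dot u (v + w) = dot u v + dot u w.
Proof. by rewrite dotC dotDl !(dotC u). Qed.

Lemma dotZr a u v : dot u (a *: v) = a * dot u v.
Proof. by rewrite dotC dotZl dotC. Qed.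

Lemma dotNl u v : dot (- u) v = - dot u v.
Proof. by rewrite -scaleN1r dotZl mulN1r. Qed.

Lemma dotNr u v : dot u (- v) = - dot u v.
Proof. by rewrite dotC dotNl dotC. Qed.

Definition dotE := (dotDl, dotDr, dotNl, dotNr, dotZl, dotZr).

Lemma sqr_enorm u : enorm u ^+ 2 = dot u u.
Proof. by rewrite sqr_sqrtr // sumr_ge0 // => i _; rewrite -expr2 sqr_ge0. Qed.

Lemma norm_le_enorm u : `|u| <= enorm u.
Proof.
have [->|] := eqVneq u 0; first by rewrite normr0 sqrtr_ge0.
rewrite -normr_eq0 => /mx_norm_neq0[[i j] /= uij].
rewrite [leLHS]uij ord1 -sqrtr_sqr; apply: ler_wsqrtr.
rewrite /dot (bigD1 j) //= -expr2 lerDl.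
by apply: sumr_ge0 => k _; rewrite -expr2 sqr_ge0.
Qed.

End Dot.

Section Gradient.
Context {R : realType} {n : nat}.
Implicit Types (g : 'rV[R]_n -> \bar R) (x y z u v : 'rV[R]_n).

Lemma near_line z v (P : set 'rV[R]_n) : (\forall y \near z, P y) ->
  \forall s \near (0 : R)^'+, P (z + s *: v).
Proof.
move=> Pz; have c : (fun s : R => z + s *: v) @ (0 : R)^'+ --> z.
  apply: cvg_at_right_filter; rewrite -[X in _ --> X]addr0 -(scale0r v).
  by apply: cvgD; [exact: cvg_cst | apply: cvgZr_tmp; exact: cvg_id].
exact: c.
Qed.

Lemma near_homothety z (p : 'rV[R]_n) (a : R) (P : set 'rV[R]_n) :
  (\forall y \near z, P y) -> \forall w \near p, P (z + a *: (w - p)).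
Proof.
move/nbhs_normP => [e /= e0 he]; apply/nbhs_normP.
have a1 : 0 < `|a| + 1 by rewrite ltr_wpDl.
exists (e / (`|a| + 1)) => [|w /= wp]; first exact: divr_gt0.
apply: he => /=; rewrite opprD addrA subrr add0r normrN normrZ distrC.
apply: le_lt_trans (_ : (`|a| + 1) * `|p - w| < e).
  by apply: ler_wpM2r; rewrite // lerDl.
by rewrite mulrC -ltr_pdivlMr.
Qed.

Lemma dot_grad g x v : ediff g x -> dot (grad g x) v = 'D_v (fine \o g) x.
Proof.
move=> [_ dx]; rewrite (deriveE _ dx) [in RHS](row_sum_delta v) linear_sum.
by apply: eq_bigr => i _; rewrite linearZ mxE (deriveE _ dx) mulrC.
Qed.

(** One-sided difference quotients turn inequalities along a segment into
    inequalities for the gradient. *)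
Lemma grad_quotient g x v : ediff g x ->
  (s^-1 * (fine (g (x + s *: v)) - fine (g x))) @[s --> (0 : R)^'+]
    --> dot (grad g x) v.
Proof.
move=> dg; rewrite dot_grad // /derive; have [_ dx] := dg.
have /cvg_dnbhs_at_right := diff_derivable (v := v) dx.
have -> : (fun h : R => h^-1 *: (((fine \o g) \o shift x) (h *: v) - (fine \o g) x))
  = (fun s : R => s^-1 * (fine (g (x + s *: v)) - fine (g x))).
  by apply: boolp.funext => s /=; rewrite (addrC x).
exact.
Qed.

Lemma grad_ge g x v (a : R) : ediff g x ->
  (\forall s \near (0 : R)^'+, s * a <= fine (g (x + s *: v)) - fine (g x)) ->
  a <= dot (grad g x) v.
Proof.
move=> dg h; apply: (cvgr_to_ge (grad_quotient (v := v) dg)).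
near=> s; have s0 : 0 < s by near: s; exact: nbhs_right_gt.
by rewrite mulrC ler_pdivlMr // mulrC; near: s.
Unshelve. all: by end_near. Qed.

Lemma grad_le g x v (a : R) : ediff g x ->
  (\forall s \near (0 : R)^'+, fine (g (x + s *: v)) - fine (g x) <= s * a) ->
  dot (grad g x) v <= a.
Proof.
move=> dg h; apply: (cvgr_to_le (grad_quotient (v := v) dg)).
near=> s; have s0 : 0 < s by near: s; exact: nbhs_right_gt.
by rewrite mulrC ler_pdivrMr // mulrC; near: s.
Unshelve. all: by end_near. Qed.

Lemma ediff_fin g x : ediff g x -> g x \is a fin_num.
Proof. by case=> /nbhs_singleton. Qed.

Lemma fin_numP_edom g x : never_ninfty g -> edom g x -> g x \is a fin_num.
Proof. by move=> gN gx; rewrite fin_numE -ltNye gN lt_eqF. Qed.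

Lemma convex_fin g x y (t : R) : never_ninfty g -> convex_fun g ->
    g x \is a fin_num -> g y \is a fin_num -> 0 <= t <= 1 ->
  g (t *: x + (1 - t) *: y) \is a fin_num /\
  fine (g (t *: x + (1 - t) *: y)) <= t * fine (g x) + (1 - t) * fine (g y).
Proof.
move=> gN gc gx gy t01; have := gc x y t t01.
rewrite -{1}(fineK gx) -{1}(fineK gy) -!EFinM -EFinD => h.
have f : g (t *: x + (1 - t) *: y) \is a fin_num.
  by apply: fin_numP_edom => //; apply: le_lt_trans h _; exact: ltry.
split=> //; rewrite -lee_fin fineK; [exact: h | exact: f].
Qed.

Lemma gradient_inequality g x y : never_ninfty g -> convex_fun g ->
  ediff g y -> g x \is a fin_num ->
  dot (grad g y) (x - y) <= fine (g x) - fine (g y).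
Proof.
move=> gN gc dy gx; apply: grad_le => //; near=> s.
have s0 : 0 < s by near: s; exact: nbhs_right_gt.
have s1 : s <= 1 by near: s; apply: nbhs_right_le.
have -> : y + s *: (x - y) = s *: x + (1 - s) *: y.
  by rewrite scalerBr scalerBl scale1r addrCA.
have s01 : 0 <= s <= 1 by rewrite (ltW s0) s1.
have [_] := convex_fin gN gc gx (ediff_fin dy) s01.
lra.
Unshelve. all: by end_near. Qed.

Lemma edom_line g x y (t : R) : never_ninfty g -> convex_fun g ->
  edom g x -> edom g y -> 0 <= t <= 1 -> edom g (t *: x + (1 - t) *: y).
Proof.
move=> hN hc hx hy t01.
have [hw _] := convex_fin hN hc (fin_numP_edom hN hx) (fin_numP_edom hN hy) t01.
by rewrite /edom /= -(fineK hw) ltry.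
Qed.

Lemma ediff_near_bounded g z : ediff g z -> exists2 e : R, 0 < e &
  forall v, `|v| < e -> g (z + v) \is a fin_num /\ fine (g (z + v)) <= fine (g z) + 1.
Proof.
move=> [hfin dz].
have c : {for z, continuous (fine \o g)} by exact: differentiable_continuous.
have /nbhs_normP[e /= e0 he] : \forall y \near z, fine (g y) <= fine (g z) + 1.
  by apply: (cvgr_le _ c); rewrite /= ltrDl.
have /nbhs_normP[e' /= e'0 he'] := hfin.
exists (Num.min e e') => [|v]; first by rewrite lt_min e0.
rewrite lt_min => /andP[ve ve']; split.
  by apply: he'; rewrite /= opprD addrA subrr add0r normrN.
by apply: he; rewrite /= opprD addrA subrr add0r normrN.
Qed.

End Gradient.

(** * Relative interior *)

Section RelativeInterior.
Context {R : realType} {n : nat}.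
Implicit Types (A : set 'rV[R]_n) (x y z u : 'rV[R]_n).

Lemma sub_affine_hull A : A `<=` affine_hull A.
Proof.
move=> x Ax; exists 1%N, (fun=> 1), (fun=> x).
by split=> //; rewrite big_ord1 ?scale1r.
Qed.

Lemma affine_hull_line A x y (t : R) : affine_hull A x -> affine_hull A y ->
  affine_hull A (t *: x + (1 - t) *: y).
Proof.
move=> [m [a [p [Ap a1 ->]]]] [k [b [q [Aq b1 ->]]]].
exists (m + k)%N,
  (fun i : 'I_(m + k) =>
     match fintype.split i with inl j => t * a j | inr j => (1 - t) * b j end),
  (fun i : 'I_(m + k) =>
     match fintype.split i with inl j => p j | inr j => q j end); split.
- by move=> i; case: (fintype.split i).
- rewrite big_split_ord /=; under eq_bigr do rewrite (unsplitK (inl _)).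
  under [X in _ + X]eq_bigr do rewrite (unsplitK (inr _)).
  by rewrite -!mulr_sumr a1 b1; ring.
- rewrite big_split_ord /=.
  under [X in _ = X + _]eq_bigr do rewrite (unsplitK (inl _)) -scalerA.
  under [X in _ = _ + X]eq_bigr do rewrite (unsplitK (inr _)) -scalerA.
  by rewrite -!scaler_sumr.
Qed.

Lemma rint_sub A : rint A `<=` A. Proof. by move=> x []. Qed.

Lemma interior_rint A : interior A `<=` rint A.
Proof.
move=> x Ax; split; first exact: interior_subset.
by apply: filterS Ax => y Ay _.
Qed.

(** From a relative interior point one can move a little towards any point of the
    affine hull, including points outside the set. *)
Lemma rint_line A z u : rint A z -> affine_hull A u ->
  \forall s \near (0 : R)^'+, A (z + s *: (u - z)).
Proof.
move=> [Az /near_line-/(_ (u - z)) hz] Au; near=> s.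
have : affine_hull A (z + s *: (u - z)) -> A (z + s *: (u - z)) by near: s.
apply; have -> : z + s *: (u - z) = s *: u + (1 - s) *: z.
  by rewrite scalerBr scalerBl scale1r addrCA.
by apply: affine_hull_line => //; exact: sub_affine_hull.
Unshelve. all: by end_near. Qed.

Lemma convex_set_line A x y (t : R) :
  convex_set (M := 'rV[R]_n) A -> A x -> A y -> 0 <= t <= 1 ->
  A (t *: x + (1 - t) *: y).
Proof.
move=> cA Ax Ay /andP[t0 t1].
have t01 : Itv.spec (@Itv.num_sem R) (Itv.Real `[0%Z, 1%Z]) t.
  by rewrite /= /Itv.num_sem in_itv /= t0 t1 num_real.
by have := cA x y (Itv.mk t01); rewrite !inE; apply.
Qed.

(** The homothety with centre [x] and ratio [1 / t] maps points near
    [(1 - t) x + t z] to points near [z], and preserves the affine hull. *)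
Lemma rint_conv A x z (t : R) : convex_set (M := 'rV[R]_n) A -> A x ->
  rint A z -> 0 < t <= 1 -> rint A ((1 - t) *: x + t *: z).
Proof.
move=> cA Ax [Az hz] /andP[t0 t1].
have tA y : A y -> A ((1 - t) *: x + t *: y).
  move=> Ay; have /= := @convex_set_line A y x t cA Ay Ax.
  by rewrite addrC (ltW t0) t1; apply.
split; first exact: tA.
pose p : 'rV[R]_n := (1 - t) *: x + t *: z.
have hp := near_homothety p t^-1 hz; rewrite -/p.
near=> w => Aw.
have wE : (1 - t) *: x + t *: (z + t^-1 *: (w - p)) = w.
  by rewrite scalerDr scalerA divff ?gt_eqF // scale1r addrA -/p subrKC.
rewrite -wE; apply: tA.
have : affine_hull A (z + t^-1 *: (w - p)) -> A (z + t^-1 *: (w - p)).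
  by near: w.
apply; have -> : z + t^-1 *: (w - p) = t^-1 *: w + (1 - t^-1) *: x.
  by apply/rowP => i; rewrite !mxE; field; rewrite gt_eqF.
by apply: affine_hull_line; [|exact: sub_affine_hull].
Unshelve. all: by end_near. Qed.

End RelativeInterior.

(** * The three-point inequality *)

Section ThreePoint.
Context {R : realType} {n : nat}.
Implicit Types (C : set 'rV[R]_n) (f h Psi : 'rV[R]_n -> \bar R).
Implicit Types (x y z u v w : 'rV[R]_n).

Definition real_bregman h x y : R := fine (h x) - fine (h y) - dot (grad h y) (x - y).

Lemma bregmanE h x y : h x \is a fin_num -> h y \is a fin_num ->
  bregman h x y = (real_bregman h x y)%:E.
Proof. by move=> hx hy; rewrite /bregman -(fineK hx) -(fineK hy). Qed.

Lemma real_bregman_ge0 h x y : never_ninfty h -> convex_fun h -> ediff h y ->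
  h x \is a fin_num -> 0 <= real_bregman h x y.
Proof.
move=> hN hc dy hx; have := gradient_inequality hN hc dy hx.
by rewrite /real_bregman; lra.
Qed.

Lemma real_bregman_sym h x y :
  real_bregman h x y + real_bregman h y x = dot (grad h x - grad h y) (x - y).
Proof. by rewrite /real_bregman !dotE; ring. Qed.

Definition abpg_objective h f Psi (k L : R) y z0 w : \bar R :=
  (linearization f Psi w y + k%:E * L%:E * bregman h w z0)%E.

Lemma abpg_objectiveE h f Psi (k L : R) y z0 w : f y \is a fin_num ->
  h z0 \is a fin_num -> Psi w \is a fin_num -> h w \is a fin_num ->
  abpg_objective h f Psi k L y z0 w =
    (fine (f y) + dot (grad f y) (w - y) + fine (Psi w) + k * L * real_bregman h w z0)%:E.
Proof.
move=> fy hz0 Pw hw; rewrite /abpg_objective /linearization bregmanE //.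
by rewrite -(fineK fy) -(fineK Pw).
Qed.

(** The minimizer [z] is compared with [z + s (u - z)], which lies in [C] for small
    [s > 0]; dividing by [s] gives the first-order condition in the direction
    [u - z], and the gradient terms of [h] regroup into three Bregman distances. *)
Lemma three_point C h f Psi (k L : R) y z0 z u : never_ninfty h -> convex_fun h ->
  never_ninfty Psi -> convex_fun Psi -> f y \is a fin_num -> h z0 \is a fin_num ->
  0 < k * L ->
  rint C z -> ediff h z -> Psi z \is a fin_num ->
  argmin C (abpg_objective h f Psi k L y z0) z ->
  affine_hull C u -> h u \is a fin_num -> Psi u \is a fin_num ->
  dot (grad f y) (z - y) + fine (Psi z) + k * L * real_bregman h z z0
  <= dot (grad f y) (u - y) + fine (Psi u)
     + k * L * (real_bregman h u z0 - real_bregman h u z).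
Proof.
move=> hN hc PN Pc fy hz0 kL0 Cz dz Pz [_ zmin] Cu hu Pu.
have hz := ediff_fin dz.
have : k * L != 0 by rewrite gt_eqF.
rewrite mulf_eq0 => /norP[k0 l0].
(* [a] is the least slope of [h] at [z] towards [u] compatible with minimality. *)
pose a := (- dot (grad f y) (u - z) - (fine (Psi u) - fine (Psi z))) / (k * L)
  + dot (grad h z0) (u - z).
have : a <= dot (grad h z) (u - z).
  apply: grad_ge => //; near=> s.
  have s0 : 0 < s by near: s; exact: nbhs_right_gt.
  have s1 : s <= 1 by near: s; apply: nbhs_right_le.
  have s01 : 0 <= s <= 1 by rewrite (ltW s0) s1.
  set w := z + s *: (u - z).
  have wE : w = s *: u + (1 - s) *: z.
    by apply/rowP => i; rewrite !mxE; ring.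
  have [hw _] := convex_fin hN hc hu hz s01; rewrite -wE in hw.
  have [Pw Pw_le] := convex_fin PN Pc Pu Pz s01; rewrite -wE in Pw Pw_le.
  have Cw : C w by rewrite /w; near: s; exact: rint_line.
  have := zmin w Cw; rewrite !abpg_objectiveE // lee_fin => le_w.
  rewrite -(ler_pM2l kL0).
  have -> : k * L * (s * a) = s * (- dot (grad f y) (u - z) -
      (fine (Psi u) - fine (Psi z)) + k * L * dot (grad h z0) (u - z)).
    by rewrite /a; field; rewrite k0 l0.
  have dw p : dot p w = dot p z + s * (dot p u - dot p z) by rewrite /w !dotE.
  clearbody w.
  move: le_w; rewrite /real_bregman !dotE !dw => le_w.
  nra.
rewrite -(ler_pM2l kL0).
have -> : k * L * a = - dot (grad f y) (u - z) -
    (fine (Psi u) - fine (Psi z)) + k * L * dot (grad h z0) (u - z).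
  by rewrite /a; field; rewrite k0 l0.
rewrite /real_bregman !dotE; lra.
Unshelve. all: by end_near. Qed.

End ThreePoint.

(** * Kernels with a scaling exponent larger than one *)
Section QuadraticKernel.
Context {R : realType} {n : nat}.
Implicit Types (h : 'rV[R]_n -> \bar R) (x y z u v w : 'rV[R]_n).

(** A point of the segment is a convex combination of a point of the domain close to
    [b] and of a point close to [z]. *)
Lemma interior_segment h z b (s : R) : never_ninfty h -> convex_fun h ->
  interior (edom h) z -> closure (edom h) b -> 0 < s <= 1 ->
  interior (edom h) (b + s *: (z - b)).
Proof.
move=> hN hc /nbhs_normP[e /= e0 he] clb /andP[s0 s1].
have se0 : 0 < s * (e / 2) by rewrite mulr_gt0 // divr_gt0.
have [b' [hb' /= bb']] := clb _ (nbhsx_ballx b _ se0).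
pose p : 'rV[R]_n := b + s *: (z - b); 
suff: \forall w \near p, edom h w by [].
apply/nbhs_normP; exists (s * (e / 2)) => //= w wp.
pose q := z + s^-1 *: (w - p) + ((1 - s) / s) *: (b - b').
have -> : w = s *: q + (1 - s) *: b'.
  by apply/rowP => i; rewrite !mxE; field; rewrite gt_eqF.
apply: edom_line => //; last by rewrite (ltW s0).
apply: he; rewrite /= /q -addrA opprD addrA subrr add0r normrN.
apply: le_lt_trans (ler_normD _ _) _.
rewrite !normrZ (@ger0_norm _ s^-1) ?invr_ge0 ?(ltW s0) //.
rewrite (@ger0_norm _ (1 - s)) ?subr_ge0 //.
have h1 : s^-1 * `|w - p| < e / 2.
  by rewrite mulrC ltr_pdivrMr // mulrC distrC.
have h2 : (1 - s) / s * `|b - b'| <= e / 2.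
  have /ltW h2 : `|b - b'| < s * (e / 2) by move: bb'; rewrite -ball_normE.
  rewrite mulrAC ler_pdivrMr // mulrC (mulrC (e / 2)).
  by apply: le_trans h2; rewrite ler_piMr //; lra.
rewrite [e]splitr; exact: ltr_leD.
Qed.

Section TriangleScaling.
Variables (h : 'rV[R]_n -> \bar R) (g : R).
Hypotheses (hN : never_ninfty h) (hc : convex_fun h).
Hypothesis h_leg : legendre h.
Hypothesis h_tse : uniform_TSE h g.
Hypothesis g1 : 1 < g.

Let h_diff x : interior (edom h) x -> ediff h x.
Proof. by move: h_leg => [[+ _] _]; apply. Qed.

Lemma real_bregman_tse x z z' (t : R) : interior (edom h) x -> interior (edom h) z ->
  interior (edom h) z' -> 0 <= t <= 1 ->
  real_bregman h ((1 - t) *: x + t *: z) ((1 - t) *: x + t *: z')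
    <= t `^ g * real_bregman h z z'.
Proof.
move=> hx hz hz' t01; have [_ tse] := h_tse.
have fin y : interior (edom h) y -> h y \is a fin_num by move/h_diff/ediff_fin.
have finc y : interior (edom h) y -> h ((1 - t) *: x + t *: y) \is a fin_num.
  by move=> hy; rewrite addrC; have [] := convex_fin hN hc (fin _ hy) (fin _ hx) t01.
have := tse x z z' t (interior_rint hx) (interior_rint hz) (interior_rint hz') t01.
rewrite (bregmanE (finc _ hz) (finc _ hz')) (bregmanE (fin _ hz) (fin _ hz')).
by rewrite -EFinM lee_fin.
Qed.

(** Symmetrizing the triangle scaling inequality removes the values of [h]; dividing
    by [t] leaves the exponent [g - 1 > 0] for increments of the gradient. *)
Lemma real_bregman_tse_sym x z z' (t : R) : interior (edom h) x -> interior (edom h) z ->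
  interior (edom h) z' -> 0 < t <= 1 ->
  dot (grad h ((1 - t) *: x + t *: z) - grad h ((1 - t) *: x + t *: z')) (z - z')
    <= t `^ (g - 1) * dot (grad h z - grad h z') (z - z').
Proof.
move=> hx hz hz' /andP[t0 t1]; have t01 : 0 <= t <= 1 by rewrite ltW.
have := lerD (real_bregman_tse hx hz hz' t01) (real_bregman_tse hx hz' hz t01).
rewrite -mulrDr !real_bregman_sym.
have -> : (1 - t) *: x + t *: z - ((1 - t) *: x + t *: z') = t *: (z - z').
  by apply/rowP => i; rewrite !mxE; ring.
rewrite dotZr -(mulr_powRB1 (ltW t0)) ?(lt_trans ltr01) //.
by rewrite -mulrA ler_pM2l.
Qed.


(** Along the segment from [z] to a point [b] of the closure, the slope [G] in the
    direction [z - b] satisfies [G s - G (s / 2) <= K s ^ (g - 1)]: this is triangle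
    scaling for the points with parameters [1] and [1 / 4]. The bounds at
    [s = 2 ^ - k] form a geometric series. *)
Lemma grad_segment_bounded z b : interior (edom h) z -> closure (edom h) b ->
  exists c, forall k : nat,
    c <= dot (grad h (b + (2^-1) ^+ k *: (z - b))) (z - b).
Proof.
move=> hz clb; pose P (s : R) := b + s *: (z - b).
pose G s := dot (grad h (P s)) (z - b).
have hP (s : R) : 0 < s <= 1 -> interior (edom h) (P s).
  exact: interior_segment.
pose K := G 1 - G 4^-1.
have p1 : 0 < (1 : R) <= 1 by rewrite ltr01 lexx.
have p4 : 0 < (4^-1 : R) <= 1 by apply/andP; split; lra.
have E14 : P 1 - P 4^-1 = (3 / 4) *: (z - b).
  by apply/rowP => i; rewrite !mxE; field.
have K0 : 0 <= K.
  have := real_bregman_ge0 hN hc (h_diff (hP _ p1)) (ediff_fin (h_diff (hP _ p4))).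
  have := real_bregman_ge0 hN hc (h_diff (hP _ p4)) (ediff_fin (h_diff (hP _ p1))).
  have := real_bregman_sym h (P 1) (P 4^-1); rewrite E14 dotZr dotDl dotNl /K /G.
  lra.
have Pconv t a c : (1 - t) *: P a + t *: P c = P ((1 - t) * a + t * c).
  by apply/rowP => i; rewrite !mxE; ring.
have step (s : R) : 0 < s <= 1 -> G s - G (s / 2) <= s `^ (g - 1) * K.
  (* [t = 2 s / 3] is the ratio of [s - s / 2] to [1 - 1 / 4]; the base point [a]
     is then positive, hence in the interior of the domain. *)
  move=> /andP[s0 s1]; pose t : R := 2 / 3 * s; pose a : R := s / 3 / (1 - t).
  have t0 : 0 < t by rewrite /t; lra.
  have t1 : 0 < 1 - t by rewrite /t; lra.
  have a01 : 0 < a <= 1.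
    by rewrite divr_gt0 ?divr_gt0 //= ler_pdivrMr // mul1r /t; lra.
  have ta : (1 - t) * a = s / 3 by rewrite mulrC divfK // gt_eqF.
  have E1 : (1 - t) *: P a + t *: P 1 = P s.
    by rewrite Pconv ta; congr P; rewrite /t; field.
  have E2 : (1 - t) *: P a + t *: P 4^-1 = P (s / 2).
    by rewrite Pconv ta; congr P; rewrite /t; field.
  have t01 : 0 < t <= 1 by rewrite t0; lra.
  have := real_bregman_tse_sym (hP _ a01) (hP _ p1) (hP _ p4) t01.
  rewrite E1 E2 E14 !dotZr mulrCA ler_pM2l ?divr_gt0 // !dotDl !dotNl.
  rewrite -/(G _) -/(G _) -/(G _) -/(G _) -/K => /le_trans; apply.
  apply: ler_wpM2r => //; apply: ler_powR_base.
  - by rewrite subr_ge0 ltW.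
  - exact: ltW.
  by rewrite /t ler_piMl ?ltW //; lra.
pose r : R := 2^-1 `^ (g - 1).
have r0 : 0 < r by rewrite powR_gt0.
have r1 : r < 1.
  have -> : 1 = 1 `^ (g - 1) :> R by rewrite powR1.
  by apply: gt0_ltr_powR; rewrite ?nnegrE ?subr_gt0 //; lra.
exists (G 1 - K / (1 - r)) => k; rewrite -/(P _) -/(G _).
(* The remainder of the geometric series strengthens the induction. *)
suff : G 1 - K / (1 - r) + r ^+ k * (K / (1 - r)) <= G (2^-1 ^+ k).
  apply: le_trans; rewrite lerDl mulr_ge0 ?exprn_ge0 ?(ltW r0) //.
  by rewrite divr_ge0 //; lra.
elim: k => [|k IH]; first by rewrite !expr0 mul1r subrK.
have k01 : 0 < (2^-1 : R) ^+ k <= 1 by rewrite exprn_gt0 // exprn_ile1 //; lra.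
have := step _ k01.
have -> : (2^-1 ^+ k) `^ (g - 1) = r ^+ k.
  by rewrite -(@powR_mulrn _ 2^-1) ?invr_ge0 // -powRrM mulrC powRrM powR_mulrn // ltW.
rewrite -exprSr => h1; apply: le_trans (_ : G (2^-1 ^+ k) - r ^+ k * K <= _); last lra.
apply: le_trans (lerB IH (lexx _)).
have : K / (1 - r) * (1 - r) = K by rewrite divfK // subr_eq0 gt_eqF.
rewrite exprS; set D := K / (1 - r); set q := r ^+ k => KD.
rewrite -KD; lra.
Qed.

(** At a boundary point [b], let [p k] tend to [b] along a segment from an interior
    point [z]. The slopes of [h] at [p k] towards [z] are bounded below, and [h] is
    bounded above near [z]; the gradient inequality at [p k], tested at [z + v] for
    all small [v], bounds the norm of the gradient and contradicts essential
    smoothness. *)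
Lemma closure_edom_interior : interior (edom h) !=set0 ->
  closure (edom h) `<=` interior (edom h).
Proof.
move=> [z hz] b clb; apply: contrapT => bdry.
have [c Gc] := grad_segment_bounded hz clb.
pose s (k : nat) : R := 2^-1 ^+ k.
pose p k := b + s k *: (z - b).
have s01 k : 0 < s k <= 1 by rewrite exprn_gt0 // exprn_ile1 //; lra.
have hp k : interior (edom h) (p k) by exact: interior_segment.
have p_b : p k @[k --> \oo] --> b.
  rewrite -[X in _ --> X]addr0 -(scale0r (z - b)).
  apply: cvgD; first exact: cvg_cst.
  apply: cvgZr_tmp; apply: cvg_expr; rewrite ger0_norm ?invr_ge0 //; lra.
have [[_ hgrad] _] := h_leg; have dz := h_diff hz.
have := hgrad p b hp (conj clb bdry) p_b.
have [e e0 he] := ediff_near_bounded dz.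
pose D := `|dot (grad h z) (z - b)|; pose M := 1 + D + `|c|.
have M0 : 0 < M by rewrite /M /D -addrA ltr_pwDl.
have bound k : enorm (grad h (p k)) <= 1 + 4 * M / e.
  set G := grad h (p k); set E := enorm G.
  have E0 : 0 <= E by exact: sqrtr_ge0.
  (* The test vector [a G] has norm less than [e], whatever the size of [G]. *)
  pose a := e / 2 / (1 + E).
  have E1 : 0 < 1 + E by lra.
  have a0 : 0 < a by rewrite divr_gt0 // divr_gt0.
  have [hfin hle] : h (z + a *: G) \is a fin_num /\
      fine (h (z + a *: G)) <= fine (h z) + 1.
    apply: he; rewrite normrZ gtr0_norm // mulrAC ltr_pdivrMr //.
    have := norm_le_enorm G; rewrite -/E => GE.
    have : e / 2 * `|G| <= e / 2 * E by rewrite ler_pM2l ?divr_gt0.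
    nra.
  have := gradient_inequality hN hc (h_diff (hp k)) hfin.
  have := gradient_inequality hN hc dz (ediff_fin (h_diff (hp k))).
  have -> : p k - z = - (1 - s k) *: (z - b).
    by apply/rowP => i; rewrite !mxE; ring.
  have -> : z + a *: G - p k = a *: G + (1 - s k) *: (z - b).
    by apply/rowP => i; rewrite !mxE; ring.
  have /andP[sk0 sk1] := s01 k.
  rewrite dotDr !dotZr -/G -sqr_enorm -/E => h1 h2.
  have {}Gc := Gc k; rewrite -/(s k) -/(p k) -/G in Gc.
  have c1 : - `|c| <= (1 - s k) * dot G (z - b).
    have n1 : 0 <= `|c| by [].
    have n2 : - `|c| <= c by rewrite lerNl ler_normr lexx orbT.
    have : (1 - s k) * - `|c| <= (1 - s k) * dot G (z - b).
      by apply: ler_wpM2l; [lra | exact: le_trans Gc].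
    nra.
  have D1 : - D <= - (1 - s k) * dot (grad h z) (z - b).
    have : dot (grad h z) (z - b) <= D by exact: ler_norm.
    have : 0 <= D by exact: normr_ge0.
    nra.
  have aE : a * E ^+ 2 <= M by rewrite /M; lra.
  have : e * E ^+ 2 <= 2 * M * (1 + E).
    have -> : e * E ^+ 2 = 2 * (1 + E) * (a * E ^+ 2).
      by rewrite /a; field; rewrite gt_eqF.
    by rewrite [leRHS]mulrAC ler_pM2l // mulr_gt0.
  move=> eE; rewrite leNgt; apply/negP => lt_E.
  have : 4 * M / e < E - 1 by lra.
  rewrite ltr_pdivrMr // => h3.
  have E2 : 1 < E by have := divr_gt0 (mulr_gt0 (ltr0n R 4) M0) e0; lra.
  nra.
move=> /cvgeyPge/(_ (2 + 4 * M / e))[N _ /(_ N (leqnn N))] /=.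
by rewrite lee_fin => /le_trans/(_ (bound N)); lra.
Qed.


(** The interior of the domain is open and closed along every line. *)
Lemma edom_everywhere : interior (edom h) !=set0 -> forall x, interior (edom h) x.
Proof.
move=> h0 x; have [z hz] := h0; have clint := closure_edom_interior h0.
pose P (t : R) : 'rV[R]_n := z + t *: (x - z).
have cP : continuous P.
  move=> t; apply: cvgD; first exact: cvg_cst.
  by apply: cvgZr_tmp; exact: cvg_id.
pose B := P @^-1` interior (edom h).
have oB : open B by apply: open_comp => [t _|]; [exact: cP | exact: open_interior].
have clB : closed B.
  have -> : B = P @^-1` closure (edom h).
    apply/seteqP; split=> t; last exact: clint.
    by move=> /interior_subset; exact: subset_closure.
  by apply: preimage_closed => [t _|]; [exact: cP | exact: closed_closure].
have cR : connected [set: R] by apply/connected_intervalP => a b _ _ c _.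
have : B = setT.
  apply: cR; first by exists 0; rewrite /B /= /P scale0r addr0.
    by exists B => //; rewrite setTI.
  by exists B => //; rewrite setTI.
by move/seteqP => [_ /(_ 1 I)]; rewrite /B /= /P scale1r subrKC.
Qed.

Section Everywhere.
Hypothesis h_all : forall x, interior (edom h) x.

(** For [t < 1], any pair of points [a + w, a] is the image of the pair
    [b + w / t, b] under some homothety [y |-> (1 - t) x + t y], since [x] ranges over
    the whole space; then let [t] tend to [1]. Below, [1 / t = 1 + s]. *)
Lemma real_bregman_translate_le a b w :
  real_bregman h (a + w) a <= real_bregman h (b + w) b.
Proof.
have fin y : h y \is a fin_num by exact/ediff_fin/h_diff.
have scale s : 0 < s ->
    real_bregman h (a + w) a <= real_bregman h (b + w + s *: w) b.
  move=> s0; pose t : R := (1 + s)^-1.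
  have t0 : 0 < t by rewrite invr_gt0; lra.
  have t1 : t < 1 by rewrite invf_lt1; lra.
  pose x := (1 - t)^-1 *: (a - t *: b).
  have xE : (1 - t) *: x = a - t *: b.
    by rewrite scalerA divff ?scale1r // subr_eq0 gt_eqF.
  have t01 : 0 <= t <= 1 by rewrite !ltW.
  have := real_bregman_tse (h_all x) (h_all (b + w + s *: w)) (h_all b) t01.
  have -> : (1 - t) *: x + t *: (b + w + s *: w) = a + w.
    by rewrite xE; apply/rowP => i; rewrite !mxE /t; field; rewrite gt_eqF //; lra.
  have -> : (1 - t) *: x + t *: b = a by rewrite xE subrK.
  move=> /le_trans; apply; rewrite ler_piMl //.
    by apply: real_bregman_ge0 => //; exact: h_diff.
  rewrite -[leRHS](powRr0 t); apply: ger_powR; first by rewrite t0 ltW.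
  exact: ltW (lt_trans ltr01 g1).
have c : {for b + w, continuous (fine \o h)}.
  by apply: differentiable_continuous; have [] := h_diff (h_all (b + w)).
have lim1 : fine (h (b + w + s *: w)) @[s --> (0 : R)^'+] --> fine (h (b + w)).
  by move=> P /c; exact: near_line.
have lim2 : s * dot (grad h b) w @[s --> (0 : R)^'+] --> 0 * dot (grad h b) w.
  by apply: cvg_at_right_filter; apply: cvgMr_tmp; exact: cvg_id.
have lim : fine (h (b + w + s *: w)) - s * dot (grad h b) w @[s --> (0 : R)^'+]
    --> fine (h (b + w)).
  have -> : fine (h (b + w)) = fine (h (b + w)) - 0 * dot (grad h b) w.
    by rewrite mul0r subr0.
  by apply: cvgB; [exact: lim1 | exact: lim2].
have : real_bregman h (a + w) a + fine (h b) + dot (grad h b) w <= fine (h (b + w)).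
  apply: (cvgr_to_ge lim); near=> s.
  have : real_bregman h (a + w) a <= real_bregman h (b + w + s *: w) b.
    by apply: scale; near: s; exact: nbhs_right_gt.
  rewrite [X in _ <= X -> _]/real_bregman.
  have -> : b + w + s *: w - b = w + s *: w by apply/rowP => i; rewrite !mxE; ring.
  by rewrite !dotE /=; lra.
by rewrite [X in _ -> _ <= X]/real_bregman (_ : b + w - b = w);
  [lra | rewrite addrC addKr].
Unshelve. all: by end_near. Qed.

Lemma real_bregman_translate a b w : real_bregman h (a + w) a = real_bregman h (b + w) b.
Proof. by apply/eqP; rewrite eq_le !real_bregman_translate_le. Qed.

(** By translation invariance both sides are the second difference
    [h (a + v + w) - h (a + v) - h (a + w) + h a]. *)
Lemma grad_increment_sym a v w :
  dot (grad h (a + v) - grad h a) w = dot (grad h (a + w) - grad h a) v.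
Proof.
have e b u : fine (h (b + u)) =
    fine (h b) + dot (grad h b) u + (real_bregman h (0 + u) 0).
  rewrite -(real_bregman_translate b) /real_bregman (_ : b + u - b = u);
    last by rewrite addrC addKr.
  ring.
have e1 := e (a + v) w; have e2 := e (a + w) v; have e3 := e a v; have e4 := e a w.
rewrite addrAC in e2; rewrite !dotE; lra.
Qed.

(** The increment of the gradient at [0] is linear in the test vector, hence, by
    symmetry, in the displacement. *)
Lemma grad_affine x y (t : R) w :
  dot (grad h ((1 - t) *: x + t *: y)) w =
  (1 - t) * dot (grad h x) w + t * dot (grad h y) w.
Proof.
have e v : dot (grad h v) w = dot (grad h 0) w + dot (grad h w - grad h 0) v.
  by have := grad_increment_sym 0 v w; rewrite !add0r !dotE; lra.
by rewrite (e x) (e y) e !dotE; ring.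
Qed.

Lemma real_bregman_gt0 x y : x <> y -> 0 < real_bregman h x y.
Proof.
move=> xy; have [_ sc] := h_leg.
have fin z : h z \is a fin_num by exact/ediff_fin/h_diff.
have hr z : rint (edom h) z by exact: interior_rint.
have t01 : 0 < (2^-1 : R) < 1 by apply/andP; split; lra.
have := sc x y 2^-1 (hr x) (hr y) xy t01.
rewrite -(fineK (fin x)) -(fineK (fin y)) -(fineK (fin (_ + _))).
rewrite -!EFinM -EFinD lte_fin => lt_mid.
have := gradient_inequality hN hc (h_diff (h_all y)) (fin (2^-1 *: x + (1 - 2^-1) *: y)).
have -> : 2^-1 *: x + (1 - 2^-1) *: y - y = 2^-1 *: (x - y).
  by apply/rowP => i; rewrite !mxE; ring.
rewrite dotZr /real_bregman; lra.
Qed.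

(** A quadratic kernel scales exactly with exponent [2]. *)
Lemma tse_le2 v : v <> 0 -> g <= 2.
Proof.
move=> v0; rewrite leNgt; apply/negP => g2.
have t01 : 0 < (2^-1 : R) <= 1 by apply/andP; split; lra.
have := real_bregman_tse_sym (h_all 0) (h_all v) (h_all 0) t01.
rewrite !scaler0 !add0r !subr0.
have pos : 0 < dot (grad h v - grad h 0) v.
  have := real_bregman_sym h v 0; rewrite subr0 => <-.
  by rewrite addr_gt0 ?real_bregman_gt0 // => /esym.
have -> : dot (grad h (2^-1 *: v) - grad h 0) v = 2^-1 * dot (grad h v - grad h 0) v.
  have := grad_affine 0 v 2^-1 v; rewrite scaler0 add0r !dotE => ->; ring.
rewrite ler_pM2r // leNgt => /negP; apply.
rewrite -mulr_powRB1 ?invr_ge0 ?subr_gt0 ?(lt_trans ltr01) // gtr_pMr ?invr_gt0 //.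
suff : 2^-1 `^ (g - 1 - 1) < 1 `^ (g - 1 - 1) :> R by rewrite powR1.
by apply: gt0_ltr_powR; rewrite ?nnegrE //; lra.
Qed.

End Everywhere.

End TriangleScaling.
End QuadraticKernel.

(** * The method *)

Section Method.
Context {R : realType} {n : nat}.
Variables (C : set 'rV[R]_n) (h f Psi : 'rV[R]_n -> \bar R) (L g : R).
Variables (x y z : nat -> 'rV[R]_n) (theta : nat -> R).
Hypothesis hSA : standing_assumption C h f Psi.
Hypothesis hL : relatively_smooth C h f L.
Hypothesis hg : uniform_TSE h g.
Hypothesis hM : ABPG C h f Psi L g x y z theta.

Let hN := sa_h_ninfty hSA.
Let hc := sa_h_convex hSA.
Let fN : never_ninfty f. Proof. by case: (sa_f_proper hSA). Qed.
Let fc := sa_f_convex hSA.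
Let PN : never_ninfty Psi. Proof. by case: (sa_Psi_proper hSA). Qed.
Let Pc := sa_Psi_convex hSA.
Let theta0 := abpg_theta0 hM.

Lemma abpg_theta_in01 k : 0 < theta k <= 1.
Proof. by case: k => [|k]; [rewrite theta0 ltr01 lexx | exact: (abpg_theta_itv hM)]. Qed.

Let thetaW k : 0 <= theta k <= 1.
Proof. by have /andP[/ltW-> ->] := abpg_theta_in01 k. Qed.

Lemma rint_ediff_h w : rint C w -> ediff h w.
Proof. by have [U [_ CU _ dU]] := sa_h_smooth hSA; move/CU/dU. Qed.

Lemma rint_ediff_f w : rint C w -> ediff f w.
Proof. by have [U [_ CU dU]] := sa_f_smooth hSA; move/CU/dU. Qed.

Lemma rint_interior_edom w : rint C w -> interior (edom h) w.
Proof.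
move/rint_ediff_h => [hw _]; apply: filterS hw => v hv.
by rewrite /edom /= -(fineK hv) ltry.
Qed.

Lemma abpg_z_in k : rint C (z k).
Proof.
by case: k => [|k]; [rewrite (abpg_z0 hM); exact: (abpg_x0 hM) | exact: (abpg_z_rint hM)].
Qed.

Lemma abpg_x_in k : rint C (x k).
Proof.
elim: k => [|k IH]; first exact: (abpg_x0 hM).
rewrite (abpg_x hM); apply: rint_conv; [exact: (sa_C_convex hSA) | exact: rint_sub | |].
  exact: abpg_z_in.
exact: abpg_theta_in01.
Qed.

Lemma abpg_y_in k : rint C (y k).
Proof.
rewrite (abpg_y hM); apply: rint_conv; [exact: (sa_C_convex hSA) | | |].
- exact: (rint_sub (abpg_x_in k)).
- exact: abpg_z_in.
- exact: abpg_theta_in01.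
Qed.

Definition comparator v :=
  [/\ affine_hull C v, h v \is a fin_num, f v \is a fin_num & Psi v \is a fin_num].

Let L0 : 0 < L. Proof. by case: hL. Qed.

Let kL0 k : 0 < theta k `^ (g - 1) * L.
Proof. by rewrite mulr_gt0 // powR_gt0 //; have /andP[] := abpg_theta_in01 k. Qed.

Lemma abpg_z_argmin k :
  argmin C (abpg_objective h f Psi (theta k `^ (g - 1)) L (y k) (z k))
  = [set z k.+1].
Proof. exact: abpg_z hM k. Qed.

(** If the subproblem had value [+oo], every point of [C] would be a minimizer, so
    [C] would be reduced to [z_(k+1)]; then [u] would be this point, where the
    objective is finite. *)
Lemma Psi_z_fin u k : comparator u -> Psi (z k.+1) \is a fin_num.
Proof.
move=> [Cu hu fu Pu]; apply: contrapT => /negP Pz.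
have Pzoo : Psi (z k.+1) = +oo%E.
  by move: Pz (PN (z k.+1)); case: (Psi _).
have objoo : abpg_objective h f Psi (theta k `^ (g - 1)) L (y k) (z k) (z k.+1) = +oo%E.
  rewrite /abpg_objective /linearization Pzoo.
  rewrite (bregmanE (ediff_fin (rint_ediff_h (abpg_z_in _)))
    (ediff_fin (rint_ediff_h (abpg_z_in _)))).
  by rewrite -(fineK (ediff_fin (rint_ediff_f (abpg_y_in k)))).
have [Cz zmin] : argmin C
    (abpg_objective h f Psi (theta k `^ (g - 1)) L (y k) (z k)) (z k.+1).
  by rewrite abpg_z_argmin.
have zuniq w : C w -> w = z k.+1.
  move=> Cw; suff : argmin C
      (abpg_objective h f Psi (theta k `^ (g - 1)) L (y k) (z k)) w.
    by rewrite abpg_z_argmin.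
  split=> // v Cv; apply: le_trans (zmin v Cv).
  by rewrite objoo leey.
have uz : u = z k.+1.
  have hs := rint_line (abpg_z_in k.+1) Cu.
  near (0 : R)^'+ => s.
  have s0 : 0 < s by near: s; exact: nbhs_right_gt.
  have /zuniq : C (z k.+1 + s *: (u - z k.+1)) by near: s.
  move/eqP; rewrite -subr_eq0 addrC addKr scaler_eq0 gt_eqF //= subr_eq0.
  by move/eqP.
by rewrite -uz Pu in Pz.
Unshelve. all: by end_near. Qed.

(** For [k = 0] the value [Psi (x 0)] may be infinite, but [x 1 = z 1]. *)
Lemma Psi_x_le u k : comparator u -> Psi (x k.+1) \is a fin_num /\
  fine (Psi (x k.+1)) <= (1 - theta k) * fine (Psi (x k)) + theta k * fine (Psi (z k.+1)).
Proof.
move=> hu; elim: k => [|k [IH _]].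
  rewrite (abpg_x hM) theta0 subrr scale0r scale1r add0r mul0r add0r mul1r.
  by split=> //; exact: Psi_z_fin hu.
have [] := convex_fin PN Pc (Psi_z_fin k.+1 hu) IH (thetaW k.+1).
rewrite addrC -(abpg_x hM) => Px P_le; split=> //.
by rewrite [leRHS]addrC.
Qed.

Lemma abpg_x_comparator u k : comparator u -> comparator (x k.+1).
Proof.
move=> hu; have hx := abpg_x_in k.+1; split.
- exact: sub_affine_hull (rint_sub hx).
- exact: ediff_fin (rint_ediff_h hx).
- exact: ediff_fin (rint_ediff_f hx).
- by have [] := Psi_x_le k hu.
Qed.

Definition real_objective v : R := fine (f v) + fine (Psi v).

Lemma abpg_step v k : comparator v ->
  weight theta g k * (real_objective (x k.+1) - real_objective v)
    + L * real_bregman h v (z k.+1)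
  <= (1 - theta k) * weight theta g k * (real_objective (x k) - real_objective v)
     + L * real_bregman h v (z k).
Proof.
move=> hv; have [Cv hv' fv Pv] := hv.
have /andP[th0 th1] := abpg_theta_in01 k.
have fy := ediff_fin (rint_ediff_f (abpg_y_in k)).
have dy := rint_ediff_f (abpg_y_in k).
have hz := ediff_fin (rint_ediff_h (abpg_z_in k)).
have fx := ediff_fin (rint_ediff_f (abpg_x_in k)).
have fx' := ediff_fin (rint_ediff_f (abpg_x_in k.+1)).
have hx' := ediff_fin (rint_ediff_h (abpg_x_in k.+1)).
have hy := ediff_fin (rint_ediff_h (abpg_y_in k)).
have smooth : fine (f (x k.+1)) <= fine (f (y k))
    + dot (grad f (y k)) (x k.+1 - y k) + L * real_bregman h (x k.+1) (y k).
  have [_ /(_ _ _ (rint_sub (abpg_x_in k.+1)) (abpg_y_in k))] := hL.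
  rewrite (bregmanE hx' hy) -{1}(fineK fx') -{1}(fineK fy).
  by rewrite -EFinM -!EFinD lee_fin.
have tse : real_bregman h (x k.+1) (y k) <= theta k `^ g * real_bregman h (z k.+1) (z k).
  rewrite (abpg_x hM) (abpg_y hM).
  by apply: (real_bregman_tse hN hc (sa_h_legendre hSA) hg) => //;
    apply: rint_interior_edom; rewrite ?abpg_x_in ?abpg_z_in //;
    [exact: abpg_x_in | exact: abpg_z_in | exact: abpg_z_in].
have [_ Px] := Psi_x_le k hv.
have fxg := gradient_inequality fN fc dy fx.
have fvg := gradient_inequality fN fc dy fv.
have argz : argmin C
    (abpg_objective h f Psi (theta k `^ (g - 1)) L (y k) (z k)) (z k.+1).
  by rewrite abpg_z_argmin.
have three := three_point hN hc PN Pc fy hz (kL0 k) (abpg_z_in k.+1)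
  (rint_ediff_h (abpg_z_in k.+1)) (Psi_z_fin k hv) argz Cv hv' Pv.
have thW : theta k * (theta k `^ (g - 1) * L) = theta k `^ g * L.
  by rewrite mulrA mulr_powRB1 ?ltW //; case: hg.
have x'y : dot (grad f (y k)) (x k.+1 - y k) =
    (1 - theta k) * dot (grad f (y k)) (x k - y k)
    + theta k * dot (grad f (y k)) (z k.+1 - y k).
  by rewrite (abpg_x hM) !dotE; ring.
have W0 : 0 < theta k `^ g by rewrite powR_gt0.
have th1' : 0 <= 1 - theta k by rewrite subr_ge0.
have := ler_wpM2l (ltW th0) three.
rewrite mulrDr (mulrA (theta k) (_ * L)) thW (mulrDr (theta k) (_ + _)).
rewrite (mulrA (theta k) (_ * L)) thW.
have := ler_wpM2l th1' fxg; have := ler_wpM2l (ltW th0) fvg.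
have := ler_wpM2l (ltW L0) tse; rewrite mulrA (mulrC L).
move: smooth Px; rewrite x'y => smooth Px tse_L fv_th fx_th three_th.
have wW : weight theta g k * theta k `^ g = 1 by rewrite /weight mulVf // gt_eqF.
have w0 : 0 <= weight theta g k by exact/ltW/weight_gt0/abpg_theta_in01.
have descent : real_objective (x k.+1) - real_objective v
    <= (1 - theta k) * (real_objective (x k) - real_objective v)
    + theta k `^ g * (L * real_bregman h v (z k) - L * real_bregman h v (z k.+1)).
  rewrite /real_objective; lra.
have := ler_wpM2l w0 descent.
rewrite [leRHS]mulrDr (mulrA _ (theta k `^ g)) wW; lra.
Qed.

(** If [g > 1] and the space has a nonzero vector, then [g <= 2] and
    [descent_bound] applies; in the zero space all points coincide. *)
Lemma abpg_target u k : comparator u ->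
  (forall k : nat, theta k <= g / (k%:R + g)) ->
  target g k * (real_objective (x k.+1) - real_objective u)
    <= L * real_bregman h u (z 0%N).
Proof.
move=> hu htheta.
pose d v k := L * real_bregman h v (z k).
have d_ge0 v j : comparator v -> 0 <= d v j.
  move=> [_ hv _ _]; rewrite mulr_ge0 ?(ltW L0) // real_bregman_ge0 //.
  exact/rint_ediff_h/abpg_z_in.
have x_comp j : comparator (x j.+1) by exact: abpg_x_comparator hu.
have step v j (hv : comparator v) := abpg_step j hv.
have := abpg_gamma hM; rewrite le_eqVlt => /predU1P[/esym g1|g1].
  exact: (@descent_exact _ theta g theta0 abpg_theta_in01 (abpg_theta hM) _
    comparator real_objective d x u).
have h0 : interior (edom h) !=set0.
  by exists (x 0%N); exact/rint_interior_edom/abpg_x_in.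
have leg := sa_h_legendre hSA.
have h_all := edom_everywhere hN hc leg hg g1 h0.
have [[w w0]|all0] := pselect (exists w : 'rV[R]_n, w <> 0); last first.
  have -> : x k.+1 = u.
    have e v : v = 0 :> 'rV[R]_n by apply: contrapT => v0; apply: all0; exists v.
    by rewrite (e u) (e (x _)).
  by rewrite subrr mulr0; exact: d_ge0.
have g2 := tse_le2 hN hc leg hg g1 h_all w0.
have g12 : 1 <= g <= 2 by rewrite ltW.
apply: (@descent_bound _ theta g theta0 abpg_theta_in01 (abpg_theta hM) _
    comparator real_objective d x u) => // v j hv.
have avg_grad w' i : wavg theta (fun t => dot (grad h (z t)) w') i.+1
    = dot (grad h (x i.+1)) w'.
  elim: i => [|i IH]; rewrite (abpg_x hM).
    by rewrite /= theta0 subrr scale0r scale1r mul0r mul1r !add0r.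
  by rewrite (grad_affine hN hc leg hg g1 h_all) [LHS]/= -IH.
(* [d v t - d (x j.+1) t] is affine in [grad h (z t)], whose average is
   [grad h (x j.+1)]. *)
have -> : wavg theta (d v) j.+1 = wavg theta (fun t => d (x j.+1) t +
    (L * (fine (h v) - fine (h (x j.+1)))
     + - L * dot (grad h (z t)) (v - x j.+1))) j.+1.
  by congr (wavg _ _ _); apply: boolp.funext => t; rewrite /d /real_bregman !dotE; ring.
rewrite wavgD wavgD (wavgZ _ (- L)) avg_grad (wavg_cst theta0) lerDl.
have [_ hv' _ _] := hv.
have := real_bregman_ge0 hN hc (rint_ediff_h (abpg_x_in j.+1)) hv'.
by move/(ler_wpM2l (ltW L0)); rewrite mulr0 /real_bregman; lra.
Qed.

End Method.

Local Open Scope ereal_scope.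

Theorem theorem1 (R : realType) (n : nat) (C : set 'rV[R]_n)
    (h f Psi F : 'rV[R]_n -> \bar R) (L gamma : R)
    (x y z : nat -> 'rV[R]_n) (theta : nat -> R)
    (hSA : standing_assumption C h f Psi)
    (hF : F = (fun w => f w + Psi w))
    (hL : relatively_smooth C h f L)
    (hgamma : uniform_TSE h gamma)
    (hABPG : ABPG C h f Psi L gamma x y z theta)
    (htheta : forall k : nat, (theta k <= gamma / (k%:R + gamma))%R) :
  forall u : 'rV[R]_n, edom h u -> affine_hull C u ->
  forall k : nat,
    F (x k.+1) - F u
    <= ((gamma / (k%:R + gamma)) `^ gamma * L)%:E * bregman h u (x 0%N).
Proof.
move=> u hu Cu k.
have fN : never_ninfty f by case: (sa_f_proper hSA).
have PN : never_ninfty Psi by case: (sa_Psi_proper hSA).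
have [Foo|Ffin] := eqVneq (F u) +oo; first by rewrite Foo addeNy leNye.
have fu : f u \is a fin_num.
  move: Ffin (fN u) (PN u); rewrite hF.
  by case: (f u) (Psi u) => [a||] [b||].
have Pu : Psi u \is a fin_num.
  move: Ffin (fN u) (PN u); rewrite hF.
  by case: (f u) (Psi u) => [a||] [b||].
have hu' : h u \is a fin_num by exact: fin_numP_edom (sa_h_ninfty hSA) hu.
have cu : comparator C h f Psi u by [].
have [_ hx fx Px] := abpg_x_comparator hSA hABPG k cu.
have hx0 := ediff_fin (rint_ediff_h hSA (abpg_x0 hABPG)).
have := abpg_target hSA hL hgamma hABPG k cu htheta.
rewrite (abpg_z0 hABPG) hF (bregmanE hu' hx0).
rewrite -(fineK fx) -(fineK Px) -(fineK fu) -(fineK Pu) -!EFinD -EFinM lee_fin.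
have [g0 _] := hgamma.
have kg0 : (0 < k%:R + gamma)%R by rewrite ltr_wpDl.
have -> : ((gamma / (k%:R + gamma)) `^ gamma = (target gamma k)^-1)%R.
  by rewrite /target -powRN -mulN1r powRrM powR_inv1 ?invf_div // divr_ge0 ?ltW.
by rewrite -mulrA ler_pdivlMl ?target_gt0.
Qed.
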